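(* There exist two absolute constants $d_1,d_2>0$ such that, for every $f\in BLO(\mathbb{R})$, $$d_1\|f\|_{BLO}\le \|f\|_{BLO}'\le d_2\|f\|_{BLO}.$$
   Context: Functions are real valued on $\mathbb{R}$; $I$ denotes a generic compact interval of $\mathbb{R}$, $\frac{1}{|I|}\int_I$ is the integral average, $f_I=\frac1{|I|}\int_I f(x)\,dx$, and $\inf_I f$ is the essential infimum of $f$ on $I$. $BLO(\mathbb{R})$ (bounded lower oscillation) is the class of $f\in L^1_{loc}(\mathbb{R})$ such that $\|f\|_{BLO}:=\sup_I\,[f_I-\inf_I f]<\infty$; functions in $BLO$ are considered modulo constants. $BLO$ is only a cone, and $\|\cdot\|_{BLO}$ is called a norm although it is only subadditive and positively homogeneous. For $g\in L^1_{loc}(\mathbb{R})$, the Hardy–Littlewood maximal function is $Mg(x)=\sup_{I\ni x}\frac1{|I|}\int_I|g(t)|\,dt$. For $f\in BLO(\mathbb{R})$, $$\|f\|_{BLO}'=\inf\{\alpha+\|b\|_{\infty}:\ \alpha>0,\ b\in L^\infty(\mathbb{R}) \text{ such that there exists } g\in L^1_{loc}(\mathbb{R}) \text{ with } f=\alpha\log(Mg)+b\}.$$ *)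

(* Defs.v *)
From mathcomp Require Import all_boot all_order all_algebra.
From mathcomp Require Import all_classical all_reals all_analysis.
From mathcomp Require Import ess_sup_inf hoelder.
Import Order.TTheory GRing.Theory Num.Theory.
Import numFieldNormedType.Exports.

Set Implicit Arguments.
Unset Strict Implicit.
Unset Printing Implicit Defensive.

Local Open Scope classical_set_scope.
Local Open Scope ring_scope.
Local Open Scope ereal_scope.

(* A function is represented by a Borel measurable [f : R -> R]; elements of
   L^1_loc, L^oo and BLO are such functions up to a.e. equality. *)
Section BLO.
Context {R : realType}.
Local Notation mu := (@lebesgue_measure R).
Implicit Types f g b : R -> R.

Definition average f (I : set R) : \bar R :=
  (mu I)^-1 * \int[mu]_(x in I) (f x)%:E.

Definition ess_inf_itv f (u v : R) : \bar R :=
  ess_inf (mrestr mu (measurable_itv `[u, v])) (EFin \o f).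

Definition BLO_norm f : \bar R :=
  ereal_sup [set z | exists u v : R, (u < v)%R /\
                     z = average f `[u, v] - ess_inf_itv f u v].

Definition BLO f : Prop := locally_integrable setT f /\ BLO_norm f < +oo.

(* The library's [HL_maximal] is the centered operator; this is the uncentered
   one.  [iavg] is the integral average of the absolute value. *)
Definition maximal g (x : R) : \bar R :=
  ereal_sup [set z | exists u v : R,
    [/\ (u < v)%R, `[u, v]%classic x & z = iavg g `[u, v]]].

(* [lne] is -oo at 0 and +oo at +oo, and [f] is finite, so the equality forces
   [0 < maximal g < +oo] almost everywhere. *)
Definition log_maximal_repr f (alpha : R) b : Prop :=
  [/\ (0 < alpha)%R, b \in Lfun mu +oo &
      exists g, locally_integrable setT g /\
        \forall x \ae mu, (f x)%:E = alpha%:E * lne (maximal g x) + (b x)%:E].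

Definition BLO_norm' f : \bar R :=
  ereal_inf [set z | exists alpha b, log_maximal_repr f alpha b /\
                     z = alpha%:E + 'N[mu]_+oo[EFin \o b]].

End BLO.

(* Main.v *)
Require Import Defs.
From mathcomp Require Import all_boot all_order all_algebra.
From mathcomp Require Import all_classical all_reals all_analysis.
From mathcomp Require Import measurable_realfun ess_sup_inf hoelder ring lra.
Import Order.TTheory GRing.Theory Num.Theory.
Import numFieldNormedType.Exports.

Set Implicit Arguments.
Unset Strict Implicit.
Unset Printing Implicit Defensive.

Local Open Scope classical_set_scope.
Local Open Scope ring_scope.
Local Open Scope ereal_scope.

(** Both inequalities go through the weights that satisfy M w <= C w almost
everywhere, Muckenhoupt's A_1 weights: BLO is the set of nonnegative multiples of
logarithms of such weights.

Upper bound for the maximal norm. Let N > 0 bound the BLO norm of f, and let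
m(J) and A(J) be the essential infimum and the mean of f over an interval J, so
that 0 <= A(J) - m(J) <= N. The one-sided John-Nirenberg inequality says that
w = exp(f / (4 N)) has mean at most 3 exp(m(J) / (4 N)) on every J
([integral_expR_le]). Its proof uses no stopping time: the Bellman function
exp(m / (4 N)) (1 + (A - m) / N) does not increase, on average, when J is
bisected ([bellman_mid]): A is the average of its values on the halves, m can only
grow there, by at most 2 N, and such a growth of m with A fixed lowers the
function. Hence its integral over the dyadic cells of any generation is at most its
value on J times the length of J ([dyadic_supermartingale]). Along the cells around
a Lebesgue point the means tend to f, and Fatou's lemma concludes. Therefore w <= M w <= 6 w almost
everywhere, and f = 4 N log (M w) + b with |b| <= 4 N log 6
([BLO_norm'_le]).

Lower bound. Let f = alpha log (M g) + b, fix an interval I, and let s be the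
infimum of M g on I. Every interval containing I has |g|-mean at most s. An
interval of length at least |I| that meets I sits with I in an interval at most
twice as long, hence its mean is at most 2 s. So where M g exceeds c s on I,
with c >= 2, it does so because of short intervals, which only see g on the
threefold dilate 3 I; the weak type (1,1) inequality for the restriction of g to
3 I, whose mean is at most s, then gives that M g > c s on a part of I of measure
at most 27 |I| / c ([maximal_weak]). Since log (M g / s) is at most the number of
integers k >= 0 with M g > e^k s, summing over k bounds its mean on I by 54
([integral_log_layers]). If B is the essential bound of |b|, then
f >= alpha log s - B on I, so the oscillation A(I) - m(I) is at most 54 alpha + 2 B
([BLO_norm_le_repr]). *)

(** * Integration on compact intervals *)

#[local] Instance ae_lebesgue_filter (R : realType) :
  Filter (almost_everywhere (@lebesgue_measure R)) :=
  ae_filter_ringOfSetsType (@lebesgue_measure R).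

Section integration.
Context {R : realType}.
Local Notation mu := (@lebesgue_measure R).
Implicit Types (f g : R -> R) (u v x : R).

Lemma mu_itv u v : (u <= v)%R -> mu `[u, v] = (v - u)%:E.
Proof.
move=> uv; rewrite lebesgue_measure_itv/= lte_fin.
have [//|vu] := ltP u v.
by rewrite (@le_anti _ _ u v) ?uv// subrr.
Qed.

Lemma ae_itv_ex u v (P : R -> Prop) : (u < v)%R ->
  (\forall x \ae mu, `[u, v]%classic x -> P x) ->
  exists2 x, (u <= x <= v)%R & P x.
Proof.
move=> uv [A [mA A0 PA]]; apply: contrapT => nP.
have : mu `[u, v] <= mu A.
  apply: le_measure; rewrite ?inE//.
  move=> x xI; apply: PA => /= Px; apply: nP; exists x; last exact: Px.
  by move: xI; rewrite /= in_itv.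
by rewrite A0 mu_itv ?(ltW uv)// lee_fin leNgt subr_gt0 uv.
Qed.

Lemma ae_le_integral (D : set R) (f g : R -> \bar R) : measurable D ->
  mu.-integrable D f -> mu.-integrable D g ->
  (\forall x \ae mu, D x -> f x <= g x) ->
  \int[mu]_(x in D) f x <= \int[mu]_(x in D) g x.
Proof.
move=> mD /integrableP[mf _] /integrableP[mg _] fg.
rewrite integralE [leRHS]integralE leeB//.
- apply: ae_ge0_le_integral => //; [exact: measurable_funepos..|].
  apply: filterS fg => x + Dx => /(_ Dx) fgx.
  by rewrite !funeposE ge_max !le_max fgx lexx orbT.
- apply: ae_ge0_le_integral => //; [exact: measurable_funeneg..|].
  apply: filterS fg => x + Dx => /(_ Dx) fgx.
  by rewrite !funenegE ge_max !le_max leeN2 fgx lexx orbT.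
Qed.

(** Fatou's lemma in the form of a closure property: a uniform bound on the
integrals passes to an almost everywhere limit. *)
Lemma fatou_ae_le (D : set R) (G : nat -> R -> \bar R) (W : R -> \bar R) c :
  measurable D -> (forall n, measurable_fun D (G n)) ->
  (forall n x, D x -> 0 <= G n x) ->
  measurable_fun D W -> (forall x, D x -> 0 <= W x) ->
  (\forall x \ae mu, D x -> G n x @[n --> \oo] --> W x) ->
  (forall n, \int[mu]_(x in D) G n x <= c) ->
  \int[mu]_(x in D) W x <= c.
Proof.
move=> mD mG G0 mW W0 GW Gc.
apply: (@le_trans _ _ (\int[mu]_(x in D) limn_einf (G ^~ x))).
  apply: ae_ge0_le_integral => //.
  - move=> x Dx; rewrite limn_einf_lim; apply: lime_ge; first exact: is_cvg_einfs.
    by apply: nearW => n; apply: le_ereal_inf_tmp => _ [m /= nm <-]; exact: G0.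
  - rewrite (_ : (fun x => _) = (fun x => - limn_esup ((fun n => - G n x)))).
      apply: measurableT_comp => //; apply: measurable_fun_limn_esup => n.
      by apply: measurableT_comp => //; exact: mG.
    apply/funext => x; rewrite -limn_einfN; congr limn_einf.
    by apply/funext => n /=; rewrite oppeK.
  - apply: filterS GW => x + Dx => /(_ Dx) GWx.
    by have [-> _] := cvg_limn_einf_sup GWx.
apply: (le_trans (fatou mu mD mG G0)).
rewrite limn_einf_lim; apply: lime_le; first exact: is_cvg_einfs.
apply: nearW => n; apply: le_trans (Gc n).
by apply: ereal_inf_lbound; exists n => /=.
Qed.

Lemma locally_integrable_itv f u v : locally_integrable setT f ->
  mu.-integrable `[u, v] (EFin \o f).
Proof.
move=> [mf _ lf]; apply/integrableP; split.
  by apply/measurable_EFinP; exact: measurable_funS mf.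
by apply: lf => //; exact: segment_compact.
Qed.

Lemma ae_mrestr (D : set R) (mD : measurable D) (P : set R) :
  (\forall x \ae mrestr mu mD, P x) <-> (\forall x \ae mu, D x -> P x).
Proof.
split=> -[N [mN N0 PN]].
  exists (N `&` D); split => //; first exact: measurableI.
  by move=> x /= /not_implyP[Dx nPx]; split => //; exact: PN.
exists (N `|` ~` D); split.
- by apply: measurableU => //; exact: measurableC.
- rewrite /= /mrestr setIUl setICl setU0.
  by apply: (subset_measure0 _ mN) => //; exact: measurableI.
- move=> x /= nPx; have [Dx|] := pselect (D x); last by right.
  by left; apply: PN => /= /(_ Dx).
Qed.

Lemma ess_inf_itvP f u v (y : \bar R) :
  y <= ess_inf_itv f u v <-> (\forall x \ae mu, `[u, v]%classic x -> y <= (f x)%:E).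
Proof. by rewrite -(ae_mrestr (measurable_itv `[u, v])); split => /ess_infP. Qed.

Lemma ess_inf_itvS f u v u' v' : (u <= u')%R -> (v' <= v)%R ->
  ess_inf_itv f u v <= ess_inf_itv f u' v'.
Proof.
move=> uu' vv'; apply/ess_inf_itvP.
have /ess_inf_itvP := lexx (ess_inf_itv f u v).
apply: filterS => x + xI; apply; move: xI => /=; rewrite !in_itv/=.
by move=> /andP[ux xv]; rewrite (le_trans uu' ux) (le_trans xv vv').
Qed.

Definition mean f u v : R := ((v - u)^-1 * \int[mu]_(x in `[u, v]) f x)%R.

Lemma averageE f u v : locally_integrable setT f -> (u < v)%R ->
  average f `[u, v] = (mean f u v)%:E.
Proof.
move=> lf uv; rewrite /average mu_itv ?ltW// inver subr_eq0 gt_eqF//.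
rewrite /mean EFinM /Rintegral fineK//.
by apply: integrable_fin_num => //; exact: locally_integrable_itv.
Qed.

Lemma ess_inf_itv_le_mean f u v : locally_integrable setT f -> (u < v)%R ->
  ess_inf_itv f u v <= (mean f u v)%:E.
Proof.
move=> lf uv.
have /ess_inf_itvP := lexx (ess_inf_itv f u v).
have if_ := locally_integrable_itv u v lf.
have vu0 : (0 < v - u)%R by rewrite subr_gt0.
have step (c : R) : (\forall x \ae mu, `[u, v]%classic x -> c%:E <= (f x)%:E) ->
    (c <= mean f u v)%R.
  move=> cf; rewrite /mean ler_pdivlMl// mulrC.
  rewrite -lee_fin /Rintegral fineK; last exact: integrable_fin_num.
  have -> : (c * (v - u))%:E = \int[mu]_(x in `[u, v]) c%:E.
    by rewrite integral_cst//= (mu_itv (ltW uv)).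
  apply: ae_le_integral => //.
  apply/integrableP; split; first exact: measurable_cst.
  by rewrite integral_cst//= (mu_itv (ltW uv)) ltry.
case: (ess_inf_itv f u v) => [r /step|+|_]; first by rewrite lee_fin.
- move=> H; have /step : \forall x \ae mu, `[u, v]%classic x ->
      (mean f u v + 1)%:E <= (f x)%:E.
    by apply: filterS H => x + xI => /(_ xI).
  by rewrite gerDl ler10.
- exact: leNye.
Qed.

Lemma Rintegral_itv_split f u w v : (u <= w <= v)%R ->
  locally_integrable setT f ->
  (\int[mu]_(x in `[u, v]) f x =
   \int[mu]_(x in `[u, w]) f x + \int[mu]_(x in `[w, v]) f x)%R.
Proof.
move=> /andP[uw wv] lf.
have /eqP : (\int[mu]_(x in `[u, v]) f x - \int[mu]_(x in `[u, w]) f x =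
             \int[mu]_(x in `]w, v]) f x)%R.
  apply: (@Rintegral_itvB _ f (BLeft u) (BRight v) w); rewrite ?bnd_simp//.
  exact: locally_integrable_itv.
rewrite subr_eq addrC => /eqP ->; rewrite Rintegral_itv_obnd_cbnd//.
by apply: integrableS (locally_integrable_itv w v lf) => //; exact: subset_itv_oc_cc.
Qed.

(** The interval [u n, v n] has at least a quarter of the measure of the ball of
radius 2 (v n - u n) around x, hence it shrinks nicely to x. Differentiation along
nicely shrinking sets needs such a family at every point: the interval is
translated from x to y. *)
Lemma average_cvg f x (u v : R ^nat) : locally_integrable setT f ->
  lebesgue_pt f x -> (forall n, u n <= x <= v n)%R -> (forall n, u n < v n)%R ->
  (v n - u n)%R @[n --> \oo] --> 0%R ->
  average f `[u n, v n] @[n --> \oo] --> (f x)%:E.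
Proof.
move=> lf fx uxv uv d0.
pose E (y : R) n := `[(y - (x - u n))%R, (y + (v n - x))%R]%classic.
have r0 n : (0 < 2 * (v n - u n))%R by rewrite mulr_gt0// subr_gt0.
have nE y : nicely_shrinking y (E y).
  split=> [n|]; first exact: measurable_itv.
  exists (4%R, fun n => PosNum (r0 n)); split => //=.
  - by rewrite -(mulr0 2%R); apply: cvgM => //; exact: cvg_cst.
  - move=> n z; rewrite /E/= in_itv/= /ball/= ltr_norml => /andP[].
    have := uv n; have /andP[] := uxv n.
    by move=> *; apply/andP; split; lra.
  - move=> n; rewrite (lebesgue_measure_ball _ (ltW (r0 n))) mu_itv; last first.
      by have := uv n; have /andP[] := uxv n; lra.
    by rewrite -EFinM lee_fin -mulr_natl; lra.
have := nice_lebesgue_differentiation nE lf fx.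
rewrite /E/average.
by under eq_fun do rewrite subKr addrC subrK.
Qed.

End integration.

(** * Dyadic cells *)

Section dyadic.
Context {R : realType}.
Local Notation mu := (@lebesgue_measure R).
Implicit Types (f g : R -> R) (u v w x : R) (h : R -> R -> R).
Local Open Scope ring_scope.

Definition mid u v : R := (u + v) / 2.

Lemma mid_lt u v : u < v -> u < mid u v < v.
Proof. by rewrite /mid => uv; apply/andP; split; lra. Qed.

(** The dyadic cell of generation n of the interval [u, v] that contains x, given
by its endpoints. *)
Fixpoint cell n u v x : R * R :=
  if n is n'.+1 then
    if x < mid u v then cell n' u (mid u v) x else cell n' (mid u v) v x
  else (u, v).

Lemma cellP n u v x : u < v -> u <= x <= v ->
  let c := cell n u v x in
  [/\ c.1 <= x <= c.2, c.1 < c.2 & c.2 - c.1 = (v - u) / 2 ^+ n].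
Proof.
elim: n u v => [|n IH] u v uv uxv /=; first by rewrite expr0 divr1.
have /andP[um mv] := mid_lt uv; have /andP[ux xv] := uxv.
rewrite exprS invfM mulrA; case: ltP => xm.
  have [|? ? ->] := IH _ _ um; first by rewrite ux ltW.
  by split => //; congr (_ / _); rewrite /mid; lra.
have [|? ? ->] := IH _ _ mv; first by rewrite xm xv.
by split => //; congr (_ / _); rewrite /mid; lra.
Qed.

Lemma measurable_cell h n u v :
  measurable_fun setT (fun x => h (cell n u v x).1 (cell n u v x).2).
Proof.
elim: n u v => [|n IH] u v /=; first exact: measurable_cst.
rewrite (_ : (fun x => _) = (fun x => if x < mid u v
  then h (cell n u (mid u v) x).1 (cell n u (mid u v) x).2
  else h (cell n (mid u v) v x).1 (cell n (mid u v) v x).2)); last first.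
  by apply/funext => x; case: ifP.
by apply: measurable_fun_ifT => //; exact: measurable_fun_ltr.
Qed.

(** The hypothesis on h says that its value on an interval dominates the average
of its values on the two halves; the integral over the cells of generation n then
decreases with n. *)
Lemma dyadic_supermartingale h n u v :
  (forall a b, a < b -> 0 <= h a b) ->
  (forall a b, a < b -> h a (mid a b) + h (mid a b) b <= 2 * h a b) ->
  u < v ->
  (\int[mu]_(x in `[u, v]) (h (cell n u v x).1 (cell n u v x).2)%:E <=
   ((v - u) * h u v)%:E)%E.
Proof.
move=> h0 hmid; elim: n u v => [|n IH] u v uv.
  by rewrite /= integral_cst//= (mu_itv (ltW uv)) -EFinM mulrC.
have /andP[um mv] := mid_lt uv.
rewrite (@itv_bndbnd_setU _ _ _ (BLeft (mid u v))) ?bnd_simp ?(ltW um) ?(ltW mv)//.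
rewrite ge0_integral_setU//=; first last.
- apply/disj_setPRL => z/=; rewrite !in_itv/= => /andP[mz _].
  by rewrite ltNge mz andbF.
- move=> x; case => /=; rewrite in_itv/= => /andP[ax xb]; rewrite lee_fin.
    rewrite xb; have [|_ + _] := @cellP n _ _ x um; last exact: h0.
    by rewrite ax/= ltW.
  rewrite ltNge ax/=; have [|_ + _] := @cellP n _ _ x mv; last exact: h0.
  by rewrite ax/= xb.
- apply/measurable_EFinP; apply: measurable_funTS.
  exact: (measurable_cell h n.+1 u v).
have -> : ((v - u) * h u v = (mid u v - u) * (2 * h u v))%R.
  by rewrite /mid; lra.
rewrite (@le_trans _ _ ((mid u v - u) * h u (mid u v) +
                       (v - mid u v) * h (mid u v) v)%:E)//; last first.
  have -> : (v - mid u v = mid u v - u)%R by rewrite /mid; lra.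
  by rewrite lee_fin -mulrDr ler_wpM2l ?hmid// subr_ge0 ltW.
rewrite EFinD; apply: leeD.
- apply: le_trans (IH _ _ um).
  rewrite -[leRHS]integral_itv_bndo_bndc; last first.
    by apply/measurable_EFinP; apply: measurable_funTS; exact: measurable_cell.
  rewrite le_eqVlt; apply/orP; left; apply/eqP; apply: eq_integral => x.
  by rewrite inE/= in_itv/= => /andP[_ ->].
- apply: le_trans (IH _ _ mv).
  rewrite le_eqVlt; apply/orP; left; apply/eqP; apply: eq_integral => x.
  by rewrite inE/= in_itv/= => /andP[ax _]; rewrite ltNge ax.
Qed.

End dyadic.

(** * The Bellman function of an element of BLO *)

Section john_nirenberg.
Context {R : realType}.
Local Notation mu := (@lebesgue_measure R).
Implicit Types (f g : R -> R) (u v w x N : R).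

(** Real-valued version of the essential infimum, faithful on BLO by
[ess_inf_itvE]. *)
Definition einf f u v : R := fine (ess_inf_itv f u v).

Lemma mean_mid f u v : locally_integrable setT f -> (u < v)%R ->
  (mean f u (mid u v) + mean f (mid u v) v = 2 * mean f u v)%R.
Proof.
move=> lf uv; have /andP[um mv] := mid_lt uv.
rewrite /mean (@Rintegral_itv_split _ f u (mid u v) v) ?(ltW um) ?(ltW mv)//.
have -> : (mid u v - u = (v - u) / 2)%R by rewrite /mid; lra.
have -> : (v - mid u v = (v - u) / 2)%R by rewrite /mid; lra.
have : (v - u != 0)%R by rewrite subr_eq0 gt_eqF.
set d := (v - u)%R => d0.
by field.
Qed.

(** From exp(-s/4) >= 1 - s/4, since (1 + s/2)(1 - s/4) >= 1 exactly for
0 <= s <= 2. *)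
Lemma expR_le_1Dhalf (s : R) : (0 <= s <= 2 -> expR (s / 4) <= 1 + s / 2)%R.
Proof.
move=> /andP[s0 s2].
have e1 : (expR (s / 4) * expR (- (s / 4)) = 1)%R by rewrite expRxMexpNx_1.
have s1 : (0 < 1 - s / 4)%R by lra.
rewrite -(ler_pM2r s1) (@le_trans _ _ 1%R)//; last by nra.
by rewrite -[leRHS]e1 ler_wpM2l ?expR_ge0// expR_ge1Dx.
Qed.

Section bound.
Variables (f : R -> R) (N : R).
Hypotheses (lf : locally_integrable setT f) (fN : BLO_norm f <= N%:E).

Lemma BLO_average_le u v : (u < v)%R ->
  (mean f u v)%:E - ess_inf_itv f u v <= N%:E.
Proof.
move=> uv; apply: le_trans fN; apply: ereal_sup_ubound.
by exists u, v; split => //; rewrite averageE.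
Qed.

Lemma ess_inf_itvE u v : (u < v)%R -> ess_inf_itv f u v = (einf f u v)%:E.
Proof.
move=> uv; rewrite /einf fineK//; have := ess_inf_itv_le_mean lf uv.
by have := BLO_average_le uv; case: (ess_inf_itv f u v).
Qed.

Lemma einf_le_mean u v : (u < v)%R -> (einf f u v <= mean f u v)%R.
Proof. by move=> uv; rewrite -lee_fin -ess_inf_itvE// ess_inf_itv_le_mean. Qed.

Lemma mean_le_einf u v : (u < v)%R -> (mean f u v <= einf f u v + N)%R.
Proof.
move=> uv; have := BLO_average_le uv.
by rewrite ess_inf_itvE// -EFinB lee_fin lerBlDl.
Qed.

Lemma einfS u v u' v' : (u <= u')%R -> (u' < v')%R -> (v' <= v)%R ->
  (einf f u v <= einf f u' v')%R.
Proof.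
move=> uu' uv' vv'; have uv := le_lt_trans uu' (lt_le_trans uv' vv').
by rewrite -lee_fin -!ess_inf_itvE//; exact: ess_inf_itvS.
Qed.

Lemma ae_einf_le u v : (u < v)%R ->
  \forall x \ae mu, `[u, v]%classic x -> (einf f u v <= f x)%R.
Proof.
move=> uv; have /ess_inf_itvP := lexx (ess_inf_itv f u v).
by apply: filterS => x + xI => /(_ xI); rewrite ess_inf_itvE// lee_fin.
Qed.

Hypothesis N0 : (0 < N)%R.
Local Open Scope ring_scope.

(** The exponent 1 / (4 N) is small enough for the affine factor to absorb the
growth of exp when the infimum rises by at most 2 N under bisection. *)
Definition bellman u v : R :=
  expR (einf f u v / (4 * N)) * (1 + (mean f u v - einf f u v) / N).

Lemma bellman_ge u v : u < v -> expR (einf f u v / (4 * N)) <= bellman u v.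
Proof.
move=> uv; rewrite /bellman ler_peMr ?expR_ge0// lerDl divr_ge0 ?(ltW N0)//.
by rewrite subr_ge0 einf_le_mean.
Qed.

(** With the mean a fixed, raising the infimum from m to m' lowers the value: if
r = (m' - m) / N and y = (a - m') / N, then exp(r/4) (1 + y) is at most
(1 + r/2)(1 + y), and this is at most 1 + y + r because y <= 1. *)
Lemma bellman_half m m' a : m <= m' -> m' - m <= 2 * N -> m' <= a <= m' + N ->
  expR (m' / (4 * N)) * (1 + (a - m') / N) <=
  expR (m / (4 * N)) * (1 + (a - m) / N).
Proof.
move=> mm' m2 /andP[ma aN].
pose r := (m' - m) / N; pose y := (a - m') / N.
have r02 : 0 <= r <= 2.
  by rewrite /r divr_ge0 ?subr_ge0 ?(ltW N0)//= ler_pdivrMr.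
have y01 : 0 <= y <= 1.
  rewrite /y divr_ge0 ?subr_ge0 ?(ltW N0)//= ler_pdivrMr// mul1r; lra.
have -> : m' / (4 * N) = m / (4 * N) + r / 4 by rewrite /r; field; rewrite gt_eqF.
have -> : (a - m) / N = y + r by rewrite /r /y; field; rewrite gt_eqF.
rewrite -/y expRD -mulrA ler_wpM2l ?expR_ge0//.
have := expR_le_1Dhalf r02; move: r02 y01 => /andP[? ?] /andP[? ?] h.
apply: (@le_trans _ _ ((1 + r / 2) * (1 + y))); last by nra.
by rewrite ler_wpM2r//; lra.
Qed.

(** By [bellman_half] both halves may be evaluated at the infimum of the whole
interval, where the expression is affine in the mean. The infimum rises by at most
2 N on a half because the excesses of the two half means over m add up to twice
that of the whole mean, which is at most N. *)
Lemma bellman_mid u v : u < v ->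
  bellman u (mid u v) + bellman (mid u v) v <= 2 * bellman u v.
Proof.
move=> uv; have /andP[um mv] := mid_lt uv.
have mm := mean_mid lf uv.
have := mean_le_einf uv; have := mean_le_einf um; have := mean_le_einf mv.
have := einf_le_mean uv; have := einf_le_mean um; have := einf_le_mean mv.
have := einfS (lexx u) um (ltW mv); have := einfS (ltW um) mv (lexx v).
move=> *.
rewrite (@le_trans _ _ (expR (einf f u v / (4 * N)) *
    (1 + (mean f u (mid u v) - einf f u v) / N) + expR (einf f u v / (4 * N)) *
    (1 + (mean f (mid u v) v - einf f u v) / N)))//.
  by apply: lerD; apply: bellman_half; lra.
rewrite -mulrDr /bellman [leRHS]mulrCA ler_wpM2l ?expR_ge0//.
rewrite le_eqVlt; apply/orP; left; apply/eqP.
have -> : mean f u v = (mean f u (mid u v) + mean f (mid u v) v) / 2.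
  by rewrite mm; field.
by field; rewrite gt_eqF.
Qed.

End bound.
End john_nirenberg.

(** * Exponential integrability *)

Section exponential.
Context {R : realType}.
Local Notation mu := (@lebesgue_measure R).
Implicit Types (u v w x : R).

Variables (f : R -> R) (N : R).
Hypotheses (lf : locally_integrable setT f) (fN : BLO_norm f <= N%:E).
Hypothesis N0 : (0 < N)%R.

Let mf : measurable_fun setT f. Proof. by case: lf. Qed.

Let cellmean n u v x : R := mean f (cell n u v x).1 (cell n u v x).2.

Lemma cellmean_cvg u v x : (u < v)%R -> (u <= x <= v)%R -> lebesgue_pt f x ->
  (cellmean n u v x)%:E @[n --> \oo] --> (f x)%:E.
Proof.
move=> uv uxv fx.
have cP n := cellP n uv uxv.
have -> : (fun n => (cellmean n u v x)%:E) =
    (fun n => average f `[(cell n u v x).1, (cell n u v x).2]).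
  by apply/funext => n; rewrite averageE//; case: (cP n).
apply: average_cvg => //; [by move=> n; case: (cP n)..|].
have -> : (fun n => (cell n u v x).2 - (cell n u v x).1)%R =
    (fun n => (v - u) * (2^-1) ^+ n)%R.
  by apply/funext => n; case: (cP n) => _ _ ->; rewrite exprVn.
rewrite -(mulr0 (v - u)%R); apply: cvgM; first exact: cvg_cst.
by apply: cvg_expr; rewrite ger0_norm ?invr_ge0// invf_lt1// ltr1n.
Qed.

(** One-sided John-Nirenberg inequality: Fatou's lemma along the dyadic cells. The
constant is the product of the bounds 2 exp(m / (4 N)) for the Bellman function on
[u, v] and 3/2 for exp(1/4). *)
Lemma integral_expR_le u v : (u < v)%R ->
  \int[mu]_(x in `[u, v]) (expR (f x / (4 * N)))%:E <=
  (3 * (v - u) * expR (einf f u v / (4 * N)))%:E.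
Proof.
move=> uv; have vu0 : (0 < v - u)%R by rewrite subr_gt0.
(* The means, unlike the infima, converge to f at Lebesgue points; they exceed the
   infima by at most N, and this costs a factor exp(1/4) <= 3/2. *)
pose G n x := (expR ((cellmean n u v x - N) / (4 * N)))%:E.
pose V n x := (bellman f N (cell n u v x).1 (cell n u v x).2)%:E.
have mG n : measurable_fun setT (G n).
  apply/measurable_EFinP; apply: measurableT_comp => //.
  exact: (measurable_cell (fun a b => (mean f a b - N) / (4 * N))%R).
have mV n : measurable_fun setT (V n).
  by apply/measurable_EFinP; exact: measurable_cell.
have GV n x : `[u, v]%classic x -> G n x <= V n x.
  rewrite /= in_itv/= => uxv; have [_ c12 _] := cellP n uv uxv.
  rewrite lee_fin; apply: le_trans (bellman_ge lf fN N0 c12).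
  rewrite ler_expR ler_pM2r ?invr_gt0 ?mulr_gt0// lerBlDr.
  exact: mean_le_einf.
have V2 : (bellman f N u v <= 2 * expR (einf f u v / (4 * N)))%R.
  rewrite /bellman mulrC ler_wpM2r ?expR_ge0//.
  have := mean_le_einf lf fN uv.
  move=> h.
  have : ((mean f u v - einf f u v) / N <= 1)%R by rewrite ler_pdivrMr// mul1r; lra.
  lra.
have IG n : \int[mu]_(x in `[u, v]) G n x <=
    ((v - u) * (2 * expR (einf f u v / (4 * N))))%:E.
  apply: (@le_trans _ _ (\int[mu]_(x in `[u, v]) V n x)).
    apply: ge0_le_integral => //.
    - by move=> x _; rewrite lee_fin expR_ge0.
    - by apply: measurable_funTS; exact: mG.
    - by apply: measurable_funTS; exact: mV.
    - exact: GV.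
  apply: (@le_trans _ _ ((v - u) * bellman f N u v)%:E).
    apply: dyadic_supermartingale => // a b ab.
    - by rewrite (le_trans _ (bellman_ge lf fN N0 ab))// expR_ge0.
    - exact: bellman_mid.
  by rewrite lee_fin ler_wpM2l// ltW.
pose W x := (expR ((f x - N) / (4 * N)))%:E.
have mW : measurable_fun setT W.
  apply/measurable_EFinP; apply: measurableT_comp => //.
  by apply: measurable_funM => //; exact: measurable_funB.
have IW : \int[mu]_(x in `[u, v]) W x <=
    ((v - u) * (2 * expR (einf f u v / (4 * N))))%:E.
  apply: (@fatou_ae_le _ _ G) => //.
  - by move=> n; apply: measurable_funTS; exact: mG.
  - by move=> n x _; rewrite lee_fin expR_ge0.
  - exact: measurable_funTS.
  - by move=> x _; rewrite lee_fin expR_ge0.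
  apply: filterS (lebesgue_differentiation lf) => x fx.
  rewrite /= in_itv/= => uxv.
  have /fine_cvgP[_] := cellmean_cvg uv uxv fx => cf.
  apply: cvg_EFin; first by apply: nearW.
  apply: (@continuous_cvg _ _ _ _ _ _ (fun y => expR ((y - N) / (4 * N)))) => //.
  apply: continuous_comp; last exact: continuous_expR.
  apply: cvgM; last exact: cvg_cst.
  by apply: cvgB; [exact: cvg_id|exact: cvg_cst].
have -> : (fun x => (expR (f x / (4 * N)))%:E) = (fun x => (expR 4^-1)%:E * W x).
  apply/funext => x; rewrite -EFinM -expRD; congr (expR _)%:E.
  by field; rewrite gt_eqF.
rewrite ge0_integralZl_EFin ?expR_ge0//; last 2 first.
- by move=> x _; rewrite lee_fin expR_ge0.
- exact: measurable_funTS.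
apply: (@le_trans _ _ ((3 / 2)%:E * ((v - u) * (2 * expR (einf f u v / (4 * N))))%:E)).
  apply: lee_pmul => //.
  - by apply: integral_ge0 => x _; rewrite lee_fin expR_ge0.
  - have := @expR_le_1Dhalf R 1; rewrite mul1r lee_fin => h.
    by apply: (le_trans (h _)); lra.
by rewrite -EFinM lee_fin; lra.
Qed.

End exponential.

(** * The uncentered maximal function *)

Section maximal_function.
Context {R : realType}.
Local Notation mu := (@lebesgue_measure R).
Implicit Types (f g : R -> R) (u v w x : R).

Definition mass g u v : R := (\int[mu]_(x in `[u, v]) `|g x|)%R.

Lemma locally_integrable_norm g : locally_integrable setT g ->
  locally_integrable setT (fun x => `|g x|%R).
Proof.
move=> [mg oT ig]; split => //; first exact: measurableT_comp.
by move=> K KT cK; under eq_integral do rewrite normr_id; exact: ig.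
Qed.

Section props.
Variable g : R -> R.
Hypothesis lg : locally_integrable setT g.

Let mg : measurable_fun setT (fun x => `|g x|%:E).
Proof. by case: lg => mg _ _; apply/measurable_EFinP; exact: measurableT_comp. Qed.

Lemma massE u v : (mass g u v)%:E = \int[mu]_(x in `[u, v]) `|g x|%:E.
Proof.
rewrite /mass /Rintegral fineK//; apply: integrable_fin_num => //.
by apply: locally_integrable_itv; exact: locally_integrable_norm.
Qed.

Lemma mass_ge0 u v : (0 <= mass g u v)%R.
Proof. by rewrite -lee_fin massE integral_ge0. Qed.

Lemma massS u v u' v' : (u' <= u)%R -> (v <= v')%R ->
  (mass g u v <= mass g u' v')%R.
Proof.
move=> u'u vv'; rewrite -lee_fin !massE; apply: ge0_subset_integral => //.
  exact: measurable_funTS.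
move=> x /=; rewrite !in_itv/= => /andP[ux xv].
by rewrite (le_trans u'u ux) (le_trans xv vv').
Qed.

Lemma iavgE u v : (u < v)%R ->
  iavg g `[u, v] = ((v - u)^-1 * mass g u v)%:E.
Proof.
move=> uv; rewrite /iavg mu_itv ?(ltW uv)// inver subr_eq0 gt_eqF//.
by rewrite EFinM massE.
Qed.

Lemma maximal_ge u v x : (u < v)%R -> (u <= x <= v)%R ->
  ((v - u)^-1 * mass g u v)%:E <= maximal g x.
Proof.
move=> uv uxv; apply: ereal_sup_ubound; exists u, v; split => //.
by rewrite iavgE.
Qed.

Lemma maximal_gtP c x : c%:E < maximal g x ->
  exists u v, [/\ (u < v)%R, (u <= x <= v)%R & (c * (v - u) < mass g u v)%R].
Proof.
move=> /ereal_sup_gt[_ [u [v [uv uxv ->]]]]; rewrite iavgE// lte_fin => cuv.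
by exists u, v; split => //; rewrite -ltr_pdivlMr ?subr_gt0// mulrC.
Qed.

Lemma maximal_le c x :
  (forall u v, (u < v)%R -> (u <= x <= v)%R -> (mass g u v <= c * (v - u))%R) ->
  maximal g x <= c%:E.
Proof.
move=> gc; rewrite leNgt; apply/negP => /maximal_gtP[u [v [uv uxv]]].
by rewrite ltNge gc.
Qed.

Lemma maximal_ge0 x : 0 <= maximal g x.
Proof.
have x1 : (x < x + 1)%R by rewrite ltrDl.
apply: le_trans (maximal_ge x1 _); last by rewrite lexx ltW.
by rewrite lee_fin mulr_ge0 ?mass_ge0// invr_ge0 subr_ge0 ltW.
Qed.

(** The maximal function is lower semicontinuous: an interval whose mean exceeds a
can be enlarged a little on both sides with mean still above a, and then it
witnesses the same bound at all nearby points. *)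
Lemma measurable_maximal : measurable_fun setT (maximal g).
Proof.
apply: lower_semicontinuous_measurable; apply/lower_semicontinuousP => a.
rewrite openE => x /= /maximal_gtP[u [v [uv uxv auv]]].
pose D : R := (mass g u v - a * (v - u))%R.
have D0 : (0 < D)%R by rewrite subr_gt0.
have a0 : (0 <= `|a|)%R by [].
pose e : R := (D / (2 * `|a| + 2))%R.
have e0 : (0 < e)%R by rewrite divr_gt0//; lra.
have eD : (e * (2 * `|a| + 2) = D)%R by rewrite /e divfK// gt_eqF//; lra.
apply: (@filterS _ _ _ (ball x e)); last exact: nbhsx_ballx.
move=> y; rewrite /ball/= ltr_norml => /andP[xy yx].
have uv' : (u - e < v + e)%R by lra.
have uyv : (u - e <= y <= v + e)%R by move: uxv => /andP[? ?]; apply/andP; split; lra.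
apply: lt_le_trans (maximal_ge uv' uyv).
rewrite lte_fin mulrC ltr_pdivlMr; last by lra.
have ae : (a * e <= `|a| * e)%R by rewrite ler_wpM2r ?(ltW e0)// ler_norm.
have : (mass g u v <= mass g (u - e) (v + e))%R by apply: massS; lra.
apply: lt_le_trans.
have -> : (v + e - (u - e) = (v - u) + 2 * e)%R by lra.
rewrite /D in eD; rewrite mulrDr; lra.
Qed.

(** At a Lebesgue point of |g| the means over [x, x + 1/(n+1)] converge to
|g x|, and each of them is at most the maximal function. *)
Lemma ae_le_maximal : \forall x \ae mu, `|g x|%:E <= maximal g x.
Proof.
have lg' := locally_integrable_norm lg.
apply: filterS (lebesgue_differentiation lg') => x gx.
have d0 n : (x < x + n.+1%:R^-1)%R by rewrite ltrDl invr_gt0.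
have := average_cvg lg' gx (u := fun=> x) (v := fun n => (x + n.+1%:R^-1)%R).
have h1 n : (x <= x <= x + n.+1%:R^-1)%R by rewrite lexx ltW.
have -> : (fun n => x + n.+1%:R^-1 - x)%R = @harmonic R.
  by apply/funext => n; rewrite addrAC subrr add0r.
move=> /(_ h1 d0 cvg_harmonic) cv.
apply: (cvge_to_le cv).
apply: nearW => n; apply: le_trans (maximal_ge (d0 n) (h1 n)).
by rewrite averageE.
Qed.

End props.
End maximal_function.

(** * Representing an element of BLO *)

Section upper_bound.
Context {R : realType}.
Local Notation mu := (@lebesgue_measure R).
Implicit Types (f g : R -> R) (u v w x : R).

Variables (f : R -> R) (N : R).
Hypotheses (lf : locally_integrable setT f) (fN : BLO_norm f <= N%:E).
Hypothesis N0 : (0 < N)%R.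

Let mf : measurable_fun setT f. Proof. by case: lf. Qed.

Let w x : R := expR (f x / (4 * N)).

Let w0 x : (0 < w x)%R. Proof. exact: expR_gt0. Qed.

Let mw : measurable_fun setT w.
Proof. by apply: measurableT_comp => //; exact: measurable_funM. Qed.

Let lw : locally_integrable setT w.
Proof.
split => //; first exact: openT.
move=> K _ cK; have /compact_bounded[M [_ KM]] := cK.
pose M' := (`|M| + 1)%R.
have MM' : (- M' < M')%R by rewrite /M'; have := normr_ge0 M; lra.
apply: (@le_lt_trans _ _ (\int[mu]_(x in `[(- M')%R, M']) (w x)%:E)); last first.
  by apply: (le_lt_trans (integral_expR_le lf fN N0 MM')); rewrite ltry.
under eq_integral do rewrite /= (gtr0_norm (w0 _)).
apply: ge0_subset_integral => //=.
- exact: compact_measurable.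
- by apply/measurable_EFinP; exact: measurable_funTS.
- by move=> x _; rewrite lee_fin ltW.
move=> x Kx; rewrite /= in_itv/= -ler_norml; apply: KM => //.
by rewrite /M' (le_lt_trans (ler_norm M))// ltrDl.
Qed.

Let mass_le u v : (u < v)%R ->
  (mass w u v <= 3 * (v - u) * expR (einf f u v / (4 * N)))%R.
Proof.
move=> uv; rewrite -lee_fin massE//.
apply: le_trans (integral_expR_le lf fN N0 uv).
by under eq_integral do rewrite (gtr0_norm (w0 _)).
Qed.

(** Rational endpoints give a single null set for all the intervals. *)
Lemma ae_einf_rat_le : \forall x \ae mu, forall p q : rat,
  (ratr p <= x <= ratr q)%R -> (ratr p < ratr q :> R)%R ->
  (einf f (ratr p) (ratr q) <= f x)%R.
Proof.
pose P n x := if @unpickle (rat * rat)%type n is Some pq then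
  (ratr pq.1 <= x <= ratr pq.2)%R -> (ratr pq.1 < ratr pq.2 :> R)%R ->
  (einf f (ratr pq.1) (ratr pq.2) <= f x)%R else True.
have : \forall x \ae mu, forall n, P n x.
  apply/ae_foralln => n; rewrite /P; case: unpickle => [[p q]/=|]; last exact: nearW.
  have [pq|pq] := ltP (ratr p : R) (ratr q).
    apply: filterS (ae_einf_le lf fN pq) => x + pxq _; apply.
    by rewrite /= in_itv.
  exact: nearW.
apply: filterS => x Px p q pxq pq.
by have := Px (pickle (p, q)); rewrite /P pickleK/=; exact.
Qed.

(** An interval around x is contained in an interval with rational endpoints at
most twice as long; this doubles the constant 3 of [integral_expR_le]. *)
Lemma ae_maximal_le : \forall x \ae mu, maximal w x <= (6 * w x)%:E.
Proof.
apply: filterS ae_einf_rat_le => x xf; apply: maximal_le => // u v uv /andP[ux xv].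
have d0 : (0 < (v - u) / 2)%R by rewrite divr_gt0// subr_gt0.
have /rat_in_itvoo[p] : (u - (v - u) / 2 < u)%R by lra.
rewrite in_itv/= => /andP[up pu].
have /rat_in_itvoo[q] : (v < v + (v - u) / 2)%R by lra.
rewrite in_itv/= => /andP[vq qv].
have pq : (ratr p < ratr q :> R)%R by lra.
apply: (le_trans (massS lw (ltW pu) (ltW vq))).
apply: (le_trans (mass_le pq)).
have wx : (expR (einf f (ratr p) (ratr q) / (4 * N)) <= w x)%R.
  rewrite /w ler_expR ler_pM2r ?invr_gt0 ?mulr_gt0//.
  by apply: xf => //; apply/andP; split; lra.
apply: (@le_trans _ _ (3 * (ratr q - ratr p) * w x)%R).
  by rewrite ler_wpM2l// mulr_ge0// subr_ge0 ltW.
have wx0 := w0 x.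
have -> : (6 * w x * (v - u) = 3 * (2 * (v - u)) * w x)%R by ring.
by rewrite ler_wpM2r ?(ltW wx0)// ler_wpM2l//; lra.
Qed.

Lemma BLO_norm'_le : BLO_norm' f <= (4 * N * (1 + ln 6))%:E.
Proof.
pose M x : R := fine (maximal w x).
pose b x : R := (f x - 4 * N * ln (M x))%R.
have N4 : (0 < 4 * N)%R by rewrite mulr_gt0.
have ln6 : (0 <= ln 6 :> R)%R by rewrite ln_ge0// ler1n.
have mb : measurable_fun setT b.
  apply: measurable_funB => //; apply: measurable_funM => //.
  apply: measurableT_comp; first exact: measurable_ln.
  by apply: measurableT_comp; [exact: fine_measurable|exact: measurable_maximal].
have Mw : \forall x \ae mu, [/\ maximal w x = (M x)%:E, (0 < M x)%R &
    (`|b x| <= 4 * N * ln 6)%R].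
  apply: filterS2 ae_maximal_le (ae_le_maximal lw) => x.
  rewrite (gtr0_norm (w0 x)) => M6 wM.
  have Mfin : maximal w x = (M x)%:E.
    by rewrite fineK// ge0_fin_numE ?maximal_ge0// (le_lt_trans M6)// ltry.
  move: M6 wM; rewrite Mfin !lee_fin => M6 wM.
  have M0 : (0 < M x)%R := lt_le_trans (w0 x) wM.
  split => //.
  have lnw : (ln (w x) = f x / (4 * N))%R by rewrite /w expRK.
  have : (ln (w x) <= ln (M x))%R by rewrite ler_ln ?posrE.
  have : (ln (M x) <= ln 6 + ln (w x))%R.
    by rewrite -lnM ?posrE// ler_ln ?posrE// mulr_gt0.
  rewrite lnw /b => h1 h2.
  have -> : (f x = 4 * N * (f x / (4 * N)))%R.
    by field; rewrite gt_eqF.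
  rewrite -mulrBr normrM (gtr0_norm N4) ler_wpM2l ?(ltW N4)//.
  by rewrite ler_norml; apply/andP; split; lra.
have Nb : 'N[mu]_+oo[EFin \o b] <= (4 * N * ln 6)%:E.
  rewrite unlock; case: ifPn => _; last by rewrite lee_fin mulr_ge0// ltW.
  apply/ess_supP; apply: filterS Mw => x [_ _ bx].
  by rewrite /= lee_fin.
apply: (@le_trans _ _ ((4 * N)%:E + 'N[mu]_+oo[EFin \o b])); last first.
  by rewrite mulrDr mulr1 EFinD leeD2l.
apply: ereal_inf_lbound; exists (4 * N)%R, b; split => //; split => //.
  rewrite inE/=; apply/andP; split; rewrite inE//=.
  by rewrite /finite_norm (le_lt_trans Nb)// ltry.
exists w; split => //; apply: filterS Mw => x [-> M0 _].
by rewrite lne_EFin// -EFinM -EFinD /b addrC subrK.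
Qed.

End upper_bound.

(** * The logarithm of a maximal function *)

Section lower_bound.
Context {R : realType}.
Local Notation mu := (@lebesgue_measure R).
Implicit Types (f g : R -> R) (u v w x : R).

Definition superlevel g u v (c : R) : set R :=
  `[u, v] `&` [set x | c%:E < maximal g x].

(** The number of integers k >= 0 such that M g > e^k s at x, for x in [u, v]: a
layered upper bound of log (M g / s) that can be integrated term by term. *)
Definition log_layers g u v (s x : R) : \bar R :=
  \sum_(k <oo) (\1_(superlevel g u v (expR k%:R * s)) x : R)%:E.

Lemma log_layers_ge0 g u v s x : 0 <= log_layers g u v s x.
Proof. by apply: nneseries_ge0 => k _ _; rewrite lee_fin. Qed.

Lemma le_sum_indic_lt (L : R) n : (L <= n%:R)%R ->
  (L <= \sum_(0 <= k < n) (k%:R < L)%R%:R)%R.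
Proof.
elim: n => [|n IH] Ln; first by rewrite big_geq.
rewrite big_nat_recr//=.
have [/IH/le_trans->//|nL] := leP L n%:R; first by rewrite lerDl.
rewrite (@le_trans _ _ (n.+1%:R))// -natr1 lerD2r.
rewrite big_nat (eq_bigr (fun=> 1%R)) -?big_nat ?sumr_const_nat ?subn0//.
by move=> k /andP[_ kn]; rewrite (lt_trans _ nL)// ltr_nat.
Qed.

Section fixed_interval.
Variables (g : R -> R) (u v : R).
Hypotheses (lg : locally_integrable setT g) (uv : (u < v)%R).

(** The number s is the infimum of M g on [u, v]. It is positive: otherwise g would
vanish almost everywhere on the line, and M g would be zero everywhere. *)
Lemma maximal_inf_itv : (exists2 x, (u <= x <= v)%R & 0 < maximal g x < +oo) ->
  exists s : R, [/\ (0 < s)%R,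
    forall x, (u <= x <= v)%R -> s%:E <= maximal g x &
    forall p q, (p <= u)%R -> (v <= q)%R -> (mass g p q <= s * (q - p))%R].
Proof.
move=> [x0 x0uv /andP[M0 My]].
pose S := ereal_inf [set maximal g x | x in `[u, v]%classic].
have Sle x : (u <= x <= v)%R -> S <= maximal g x.
  by move=> xuv; apply: ereal_inf_lbound; exists x => //=; rewrite in_itv.
have S0 : 0 <= S.
  by apply: le_ereal_inf_tmp => _ [x _ <-]; exact: maximal_ge0.
have SE : S = (fine S)%:E.
  by rewrite fineK// ge0_fin_numE// (le_lt_trans (Sle _ x0uv)).
have Smass p q : (p <= u)%R -> (v <= q)%R -> (mass g p q <= fine S * (q - p))%R.
  move=> pu vq; have pq : (p < q)%R := le_lt_trans pu (lt_le_trans uv vq).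
  rewrite -ler_pdivrMr ?subr_gt0// mulrC -lee_fin -SE.
  apply: le_ereal_inf_tmp => _ [x + <-]; rewrite /= in_itv/= => /andP[ux xv].
  by apply: maximal_ge => //; rewrite (le_trans pu ux) (le_trans xv vq).
exists (fine S); split => //; last by move=> x /Sle; rewrite SE.
rewrite lt_neqAle fine_ge0// andbT; apply/eqP => S00.
move: M0; apply/negP; rewrite -leNgt; apply: maximal_le => // p q pq x0pq.
rewrite mul0r.
have pu : (Num.min p u <= u)%R by rewrite ge_min lexx orbT.
have vq : (v <= Num.max q v)%R by rewrite le_max lexx orbT.
apply: le_trans (massS lg _ _) (le_trans (Smass _ _ pu vq) _).
- by rewrite ge_min lexx.
- by rewrite le_max lexx.
- by rewrite -S00 mul0r.
Qed.

Variable s : R.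
Hypothesis s0 : (0 < s)%R.
Hypothesis sM : forall x, (u <= x <= v)%R -> s%:E <= maximal g x.
Hypothesis sm : forall p q, (p <= u)%R -> (v <= q)%R -> (mass g p q <= s * (q - p))%R.

Let h := g \_ `[(2 * u - v)%R, (2 * v - u)%R].

Let lh : locally_integrable setT h.
Proof.
by apply: integrable_locally_restrict => //; exact: locally_integrable_itv.
Qed.

(** An interval [p, q] at least as long as [u, v] and meeting it has mean at most
2 s, so the intervals responsible for M g > c s are short and stay in the
threefold dilate of [u, v]. The passage from [p, q] to a ball centered at x
costs the factor 3. *)
Lemma maximal_gt_HL c x : (2 <= c)%R -> (u <= x <= v)%R ->
  (c * s)%:E < maximal g x -> (c * s / 3)%:E < HL_maximal h x.
Proof.
move=> c2 /andP[ux xv] /maximal_gtP -/(_ lg)[p [q [pq /andP[px xq] cpq]]].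
have cs : (2 * s <= c * s)%R by rewrite ler_wpM2r// ltW.
have qp0 : (0 < q - p)%R by rewrite subr_gt0.
have short : (q - p < v - u)%R.
  rewrite ltNge; apply/negP => long.
  have pu : (Num.min p u <= u)%R by rewrite ge_min lexx orbT.
  have vq : (v <= Num.max q v)%R by rewrite le_max lexx orbT.
  have : (mass g p q <= s * (Num.max q v - Num.min p u))%R.
    by apply: le_trans (massS lg _ _) (sm pu vq); rewrite ?ge_min ?le_max lexx.
  have : (Num.max q v - Num.min p u <= 2 * (q - p))%R.
    by rewrite /Num.max /Num.min; case: ifP => ?; case: ifP => ?; lra.
  move=> hL hm.
  have : (s * (Num.max q v - Num.min p u) <= s * (2 * (q - p)))%R.
    by rewrite ler_wpM2l// ltW.
  have : (2 * s * (q - p) <= c * s * (q - p))%R by rewrite ler_wpM2r// ltW.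
  lra.
(* Any radius larger than q - p gives an open ball that contains [p, q]. *)
pose r := (3 / 2 * (q - p))%R.
have r0 : (0 < r)%R by rewrite mulr_gt0.
apply: (@lt_le_trans _ _ (iavg h (ball x r))); last first.
  by apply: ereal_sup_ubound; exists r => //=; rewrite in_itv/= r0.
rewrite /iavg lebesgue_measure_ball ?(ltW r0)// inver mulrn_eq0/= gt_eqF//.
apply: (@lt_le_trans _ _ ((r *+ 2)^-1%:E * (mass g p q)%:E)).
  rewrite -EFinM lte_fin [ltRHS]mulrC ltr_pdivlMr; last by rewrite mulrn_wgt0.
  by rewrite -mulr_natl /r; lra.
rewrite lee_wpmul2l ?lee_fin ?invr_ge0 ?mulrn_wge0 ?(ltW r0)// massE//.
have -> : \int[mu]_(y in `[p, q]) `|g y|%:E = \int[mu]_(y in `[p, q]) `|h y|%:E.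
  apply: eq_integral => y; rewrite inE/= in_itv/= => /andP[py yq].
  by rewrite /h patchE mem_set//= in_itv/=; apply/andP; split; lra.
apply: ge0_subset_integral => //; first exact: measurable_ball.
  by case: lh => mh _ _; apply/measurable_EFinP/measurableT_comp => //; exact: measurable_funTS.
move=> y; rewrite /= in_itv/= /ball/= ltr_norml => /andP[py yq].
by rewrite /r; apply/andP; split; lra.
Qed.

Lemma measurable_superlevel c : measurable (superlevel g u v c).
Proof.
apply: measurableI => //; rewrite -[X in measurable X]setTI.
by apply: emeasurable_fun_o_infty => //; exact: measurable_maximal.
Qed.

(** The weak type inequality with constant 3 at level c s / 3, for a function of
mass at most 3 (v - u) s: the constant is 3 * 3 * 3. *)
Lemma maximal_weak c : (2 <= c)%R ->
  mu (superlevel g u v (c * s)) <= (27 * (v - u) / c)%:E.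
Proof.
move=> c2; have c0 : (0 < c)%R by lra.
have cs3 : (0 < c * s / 3)%R by rewrite divr_gt0// mulr_gt0.
apply: (@le_trans _ _ (mu [set x | HL_maximal h x > (c * s / 3)%:E])).
  apply: le_measure; rewrite ?inE//; first exact: measurable_superlevel.
    rewrite -[X in measurable X]setTI.
    by apply: emeasurable_fun_o_infty => //; exact: measurable_HL_maximal.
  by move=> x [/=]; rewrite in_itv/= => xuv; exact: maximal_gt_HL.
apply: (le_trans (maximal_inequality lh cs3)).
have -> : \int[mu]_x `|(h x)%:E| = (mass g (2 * u - v) (2 * v - u))%:E.
  rewrite massE// [RHS]integral_mkcond; apply: eq_integral => x _.
  by rewrite /= restrict_EFin restrict_normr.
rewrite -EFinM lee_fin.
apply: (@le_trans _ _ (3 / (c * s / 3) * (s * (3 * (v - u))))%R).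
  rewrite ler_wpM2l//; first by rewrite divr_ge0// ltW.
  have -> : (3 * (v - u) = (2 * v - u) - (2 * u - v))%R by lra.
  by apply: sm; move: uv; lra.
rewrite le_eqVlt; apply/orP; left; apply/eqP.
by field; rewrite !gt_eqF.
Qed.

Lemma measurable_log_layers : measurable_fun `[u, v] (log_layers g u v s).
Proof.
apply: (@ge0_emeasurable_sum _ _ _ _
  (fun k x => (\1_(superlevel g u v (expR k%:R * s)) x : R)%:E) xpredT).
  by move=> k x _ _; rewrite lee_fin.
move=> k _; apply/measurable_EFinP; apply: measurable_indic.
exact: measurable_superlevel.
Qed.

Lemma ln_maximal_le x y : (u <= x <= v)%R -> maximal g x = y%:E ->
  (ln y)%:E <= (ln s)%:E + log_layers g u v s x.
Proof.
move=> xuv xy; have sy : (s <= y)%R by rewrite -lee_fin -xy sM.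
have y0 : (0 < y)%R := lt_le_trans s0 sy.
pose L := ln (y / s).
have -> : ln y = (ln s + L)%R by rewrite /L ln_div ?posrE// addrC subrK.
rewrite EFinD leeD2l//.
pose n := Num.bound `|L|%R.
have Ln : (L <= n%:R)%R.
  by rewrite (le_trans (ler_norm L))// ltW// archi_boundP.
apply: le_trans (@nneseries_lim_ge _ _ xpredT 0 n _); last first.
  by move=> k _ _; rewrite lee_fin.
rewrite sumEFin lee_fin (le_trans (le_sum_indic_lt Ln))//.
apply: ler_sum => k _; case: ltP => // kL.
rewrite indicE mem_set//; split; first by rewrite /= in_itv.
rewrite /= xy lte_fin -ltr_pdivlMr// -[ltRHS]lnK ?posrE ?divr_gt0//.
by rewrite ltr_expR.
Qed.

(** The layer k has measure at most 27 (v - u) / 2^k: by [maximal_weak] and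
e^k >= 2^k if k >= 1, and because it lies in [u, v] if k = 0. *)
Lemma integral_log_layers :
  \int[mu]_(x in `[u, v]) log_layers g u v s x <= (54 * (v - u))%:E.
Proof.
have vu0 : (0 < v - u)%R by rewrite subr_gt0.
rewrite integral_nneseries//; last first.
  move=> k; apply/measurable_EFinP.
  by apply: measurable_indic; exact: measurable_superlevel.
have d0 : (0 <= 54 * (v - u))%R by rewrite mulr_ge0// ltW.
apply: le_trans (epsilon_trick0 xpredT d0).
apply: lee_nneseries => k; first by move=> _; rewrite integral_ge0.
move=> _; rewrite integral_indic//; last exact: measurable_superlevel.
rewrite setIidl; last exact: subIsetl.
case: k => [|k].
  apply: (@le_trans _ _ (mu `[u, v])).
    by apply: le_measure; rewrite ?inE//; [exact: measurable_superlevel|exact: subIsetl].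
  by rewrite (mu_itv (ltW uv)) lee_fin; lra.
have e2 : (2 <= expR 1 :> R)%R by have := expR_ge1Dx (1 : R); lra.
have ek : (2 ^+ k.+1 <= expR k.+1%:R :> R)%R.
  by rewrite -[k.+1%:R]mulr1 expRM_natl lerXn2r// nnegrE.
have e2k : (2 <= expR k.+1%:R :> R)%R.
  by rewrite (le_trans e2)// ler_expR ler1n.
apply: (le_trans (maximal_weak e2k)); rewrite lee_fin.
rewrite [(2 ^ _)%N]expnS natrM natrX invfM.
have -> : (54 * (v - u) * (2^-1 * (2 ^+ k.+1)^-1) = 27 * (v - u) / 2 ^+ k.+1)%R.
  by field; rewrite expf_neq0.
by rewrite ler_wpM2l ?mulr_ge0 ?(ltW vu0)// lef_pV2 ?posrE ?expR_gt0// exprn_gt0.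
Qed.

End fixed_interval.
End lower_bound.

(** * Equivalence of the two norms *)

Section comparison.
Context {R : realType}.
Local Notation mu := (@lebesgue_measure R).
Implicit Types (f g b : R -> R) (u v w x : R).

(** With B the essential bound of b, f lies between alpha log s - B and
alpha log s + B + alpha log (M g / s) on the given interval. *)
Lemma BLO_norm_le_repr f alpha b : locally_integrable setT f ->
  log_maximal_repr f alpha b ->
  BLO_norm f <= 54%:E * (alpha%:E + 'N[mu]_+oo[EFin \o b]).
Proof.
move=> lf [a0 bL [g [lg fE]]].
pose B := fine 'N[mu]_+oo[EFin \o b].
have NB : 'N[mu]_+oo[EFin \o b] = B%:E.
  rewrite fineK// ge0_fin_numE ?Lnorm_ge0//.
  by move/sub_Lfun_finLfun : bL; rewrite inE.
have B0 : (0 <= B)%R by rewrite -lee_fin -NB Lnorm_ge0.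
have bB : \forall x \ae mu, (`|b x| <= B)%R.
  have : ess_sup mu (abse \o (EFin \o b)) <= B%:E.
    rewrite -NB unlock; suff -> : 0 < mu [set: R] by [].
    apply: (@lt_le_trans _ _ (mu `[0%R, 1%R])).
      by rewrite (mu_itv ler01) subr0 lte01.
    by apply: le_measure; rewrite ?inE.
  by move/ess_supP; apply: filterS => x; rewrite /= lee_fin.
(* Finiteness of f excludes the values 0 and +oo of the maximal function, where
   the logarithm is infinite. *)
pose good x := exists y : R, [/\ (0 < y)%R, maximal g x = y%:E,
    (f x = alpha * ln y + b x)%R & (`|b x| <= B)%R].
have {}fE : \forall x \ae mu, good x.
  apply: filterS2 fE bB => x fx bx.
  move: fx (maximal_ge0 lg x); case Mx : (maximal g x) => [y| |] fx //.
    rewrite lee_fin le_eqVlt => /predU1P[y0|y0].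
      by move: fx; rewrite -y0 le0_lneNy// gt0_muleNy ?lte_fin.
    by move: fx; rewrite lne_EFin// -EFinM -EFinD => -[fxE]; exists y; split.
  by move: fx; rewrite /lne gt0_muley ?lte_fin.
rewrite NB -EFinD -EFinM; apply: ge_ereal_sup => _ [u [v [uv ->]]].
rewrite averageE//.
have vu0 : (0 < v - u)%R by rewrite subr_gt0.
have [s [s0 sM sm]] : exists s : R, [/\ (0 < s)%R,
    forall x, (u <= x <= v)%R -> s%:E <= maximal g x &
    forall p q, (p <= u)%R -> (v <= q)%R -> (mass g p q <= s * (q - p))%R].
  apply: maximal_inf_itv => //.
  have fE' : \forall x \ae mu, `[u, v]%classic x -> good x.
    by apply: filterS fE.
  have [x xuv [y [y0 xy _ _]]] := ae_itv_ex uv fE'.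
  by exists x => //; rewrite xy lte_fin y0 ltry.
pose c0 := (alpha * ln s)%R.
have lower : (c0 - B)%:E <= ess_inf_itv f u v.
  apply/ess_inf_itvP; apply: filterS fE => x [y [y0 xy -> bx]] xuv.
  rewrite lee_fin /c0 lerD//; last by move: bx; rewrite ler_norml => /andP[].
  rewrite ler_wpM2l ?(ltW a0)// ler_ln ?posrE//.
  by rewrite -lee_fin -xy sM//; move: xuv; rewrite /= in_itv.
have upper : (mean f u v <= c0 + B + 54 * alpha)%R.
  have intf := locally_integrable_itv u v lf.
  have intc : mu.-integrable `[u, v] (EFin \o fun=> (c0 + B)%R).
    apply: locally_integrable_itv; split => //; first exact: openT.
    move=> K _ cK; rewrite integral_cst; last exact: compact_measurable.
    by rewrite lte_mul_pinfty// compact_finite_measure.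
  have intT := integral_log_layers lg uv s0 sm.
  have mT : measurable_fun `[u, v] (log_layers g u v s).
    exact: measurable_log_layers.
  have intfc : mu.-integrable `[u, v] (fun x => (f x - (c0 + B))%:E).
    have : mu.-integrable `[u, v] ((EFin \o f) \- (EFin \o fun=> (c0 + B)%R)).
      by apply: integrableB.
    by apply: eq_integrable => // x _ /=; rewrite EFinB.
  rewrite /mean ler_pdivrMl//.
  have -> : ((v - u) * (c0 + B + 54 * alpha) =
      \int[mu]_(x in `[u, v]) (c0 + B) + alpha * (54 * (v - u)))%R.
    by rewrite Rintegral_cst//= (mu_itv (ltW uv))/=; ring.
  rewrite -lerBlDl -RintegralB// -lee_fin.
  rewrite /Rintegral fineK; last exact: integrable_fin_num.
  apply: (@le_trans _ _ (\int[mu]_(x in `[u, v]) (alpha%:E * log_layers g u v s x))).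
    apply: ae_le_integral => //.
      apply/integrableP; split; first exact: measurable_funeM.
      under eq_integral do rewrite gee0_abs ?mule_ge0 ?log_layers_ge0 ?lee_fin ?(ltW a0)//.
      rewrite ge0_integralZl_EFin ?(ltW a0)//; last by move=> x _; exact: log_layers_ge0.
      by rewrite lte_mul_pinfty ?lee_fin ?(ltW a0)// (le_lt_trans intT)// ltry.
    apply: filterS fE => x [y [y0 xy -> bx]] xuv.
    have xuv' : (u <= x <= v)%R by move: xuv; rewrite /= in_itv.
    have h := ln_maximal_le s0 sM xuv' xy.
    rewrite /= -leeBlDl// in h.
    have -> : (alpha * ln y + b x - (c0 + B) =
        alpha * (ln y - ln s) + (b x - B))%R by rewrite /c0; ring.
    rewrite EFinD EFinM -[leRHS]adde0; apply: leeD.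
      by rewrite lee_pmul2l// EFinB leeBlDl.
    by rewrite lee_fin subr_le0 (le_trans (ler_norm _)).
  rewrite ge0_integralZl_EFin ?(ltW a0)//; last by move=> x _; exact: log_layers_ge0.
  by rewrite EFinM lee_wpmul2l// lee_fin ltW.
apply: (@le_trans _ _ ((c0 + B + 54 * alpha)%:E - (c0 - B)%:E)).
  by rewrite leeB// lee_fin.
by rewrite -EFinB lee_fin; lra.
Qed.

End comparison.

Theorem theorem7 (R : realType) :
  exists d1 d2 : R, (0 < d1)%R /\ (0 < d2)%R /\
    forall f : R -> R, BLO f ->
      d1%:E * BLO_norm f <= BLO_norm' f /\ BLO_norm' f <= d2%:E * BLO_norm f.
Proof.
have ln6 : (0 <= ln 6 :> R)%R by rewrite ln_ge0// ler1n.
have d2 : (0 < 4 * (1 + ln 6) :> R)%R by rewrite mulr_gt0// ltr_wpDr.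
exists 54^-1%R, (4 * (1 + ln 6))%R; split; first by rewrite invr_gt0.
split => // f [lf fy]; split.
  apply: le_ereal_inf_tmp => _ [alpha [b [fab ->]]].
  by rewrite lee_pdivrMl//; exact: BLO_norm_le_repr.
have f0 : 0 <= BLO_norm f.
  apply: (@le_trans _ _ (average f `[0%R, 1%R] - ess_inf_itv f 0 1)).
    by rewrite averageE// sube_ge0 ?orbT// ess_inf_itv_le_mean.
  by apply: ereal_sup_ubound; exists 0%R, 1%R.
have fE : BLO_norm f = (fine (BLO_norm f))%:E by rewrite fineK// ge0_fin_numE.
(* The representation of f requires a positive N, hence the margin e: the norm of
   f may be zero. *)
apply/lee_addgt0Pr => e e0.
pose N := (fine (BLO_norm f) + e / (4 * (1 + ln 6)))%R.
have N0 : (0 < N)%R by rewrite ltr_wpDl ?fine_ge0// divr_gt0.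
have fN : BLO_norm f <= N%:E by rewrite fE lee_fin lerDl divr_ge0// ltW.
apply: (le_trans (BLO_norm'_le lf fN N0)).
rewrite fE -EFinM -EFinD lee_fin mulrAC /N (mulrDr (4 * _)%R).
by rewrite (mulrC _ (e / _)%R) divfK ?gt_eqF.
Qed.
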